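(* Let $0<\mu\le L$ and let $f:\mathbb{R}^d\to\mathbb{R}$ be a convex $C^2$ function with $\mu I\preceq\nabla^2f(\mathbf{x})\preceq LI$ for all $\mathbf{x}\in\mathbb{R}^d$, and let $\mathbf{x}_*$ be its minimizer. Let $\epsilon>0$ and set $c:=\frac{2\sqrt{\mu L}}{\mu+L}$. If $\mathbf{x}\notin V_{\epsilon,c}$, then $D_{f,\Omega_{\epsilon,c}}(\mathbf{x}_*\|\mathbf{x})\ge0$, i.e. $$\langle\Omega_{\epsilon,c}(\mathbf{x}),\mathbf{x}-\mathbf{x}_*\rangle\ge f(\mathbf{x})-f(\mathbf{x}_* ).$$
   Context: Let $\mathbf{e}_i$ be the standard basis vectors. For $\epsilon>0$ define $m_i(\mathbf{x}):=\frac{f(\mathbf{x}+\epsilon\mathbf{e}_i)-f(\mathbf{x}-\epsilon\mathbf{e}_i)}{2\epsilon}$, $r_i(\mathbf{x}):=\frac{f(\mathbf{x}+\epsilon\mathbf{e}_i)+f(\mathbf{x}-\epsilon\mathbf{e}_i)-2f(\mathbf{x})}{2\epsilon}$ for $i=1,\dots,d$, $M(\mathbf{x}):=\|\mathbf{m}(\mathbf{x})\|_2$, $R(\mathbf{x}):=\|\mathbf{r}(\mathbf{x})\|_2$. For $c\in(0,1]$ the exceptional set is $V_{\epsilon,c}:=\{\mathbf{x}:M(\mathbf{x})\le R(\mathbf{x})/c\}$. For $\mathbf{x}\notin V_{\epsilon,c}$ the finite-difference vector field is $\Omega_{\epsilon,c}(\mathbf{x}):=\alpha(\mathbf{x})\mathbf{m}(\mathbf{x})$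 with $\alpha(\mathbf{x}):=\frac{c(M(\mathbf{x})^2-R(\mathbf{x})^2)}{M(\mathbf{x})(cM(\mathbf{x})-R(\mathbf{x}))}$. Also $D_{f,\Omega}(\mathbf{x}\|\mathbf{y}):=\langle\Omega(\mathbf{y}),\mathbf{y}-\mathbf{x}\rangle-f(\mathbf{y})+f(\mathbf{x})$. *)

(* Defs.v *)
From HB Require Import structures.
From mathcomp Require Import all_boot all_order all_algebra.
From mathcomp Require Import all_classical all_reals all_analysis.

Set Implicit Arguments.
Unset Strict Implicit.
Unset Printing Implicit Defensive.

Import Order.TTheory GRing.Theory Num.Theory.
Import numFieldNormedType.Exports.

Local Open Scope classical_set_scope.
Local Open Scope ring_scope.

Section Defs.
Variables (R : realType) (d : nat).

Implicit Types (f : 'rV[R]_d -> R) (u v x y : 'rV[R]_d) (A B : 'M[R]_d).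

Definition e_ (i : 'I_d) : 'rV[R]_d := delta_mx 0 i.

Definition inner u v : R := \sum_i u 0 i * v 0 i.

(* The library's norm `|v| on row vectors is the sup norm. *)
Definition norm2 v : R := Num.sqrt (\sum_i v 0 i ^+ 2).

Definition partial f (i : 'I_d) : 'rV[R]_d -> R := fun x => 'D_(e_ i) f x.

Definition C1 f : Prop :=
  (forall i x, derivable f x (e_ i)) /\ (forall i, continuous (partial f i)).

Definition C2 f : Prop := C1 f /\ forall i, C1 (partial f i).

Definition hessian f x : 'M[R]_d :=
  \matrix_(i, j) partial (partial f i) j x.

Definition psd A : Prop := forall v, 0 <= inner (v *m A) v.

(* Symmetry is not part of psd: the Loewner order is only used on Hessians of
   C2 functions and scalar matrices, which are symmetric. *)
Definition loewner_le A B : Prop := psd (B - A).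

Variables (f : 'rV[R]_d -> R) (eps c : R).

Definition m_vec x : 'rV[R]_d :=
  \row_i ((f (x + eps *: e_ i) - f (x - eps *: e_ i)) / (2 * eps)).

Definition r_vec x : 'rV[R]_d :=
  \row_i ((f (x + eps *: e_ i) + f (x - eps *: e_ i) - 2 * f x) / (2 * eps)).

Definition M_ x : R := norm2 (m_vec x).

Definition R_ x : R := norm2 (r_vec x).

Definition exceptional_set : set 'rV[R]_d := [set x | M_ x <= R_ x / c].

Definition alpha x : R :=
  c * (M_ x ^+ 2 - R_ x ^+ 2) / (M_ x * (c * M_ x - R_ x)).

(* Only meaningful outside exceptional_set, where, for 0 < c, both factors of
   the denominator of alpha are positive. *)
Definition Omega x : 'rV[R]_d := alpha x *: m_vec x.

Definition divergence (W : 'rV[R]_d -> 'rV[R]_d) x y : R :=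
  inner (W y) (y - x) - f y + f x.

End Defs.

(* Main.v *)
(* Write [g] for the gradient of [f] at [x] and [p = x - xstar]. Convexity along
   the coordinate directions gives [|g_i - m_i| <= r_i], hence [|g - m| <= R].
   Strong convexity and smoothness give the coercivity estimate
   [mu L |p|^2 + |g|^2 <= (mu + L) <g, p>], so by AM-GM the angle between [g]
   and [p] has cosine at least [c]. The scaling [alpha] is exactly the one for
   which these two facts imply [<alpha m, p> >= <g, p>], and the right-hand side
   dominates [f x - f xstar] by convexity. *)
Require Import Defs.
From HB Require Import structures.
From mathcomp Require Import all_boot all_order all_algebra.
From mathcomp Require Import all_classical all_reals all_analysis.
From mathcomp Require Import ring lra.

Import Order.TTheory GRing.Theory Num.Theory.
Import numFieldNormedType.Exports.

Local Open Scope classical_set_scope.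
Local Open Scope ring_scope.

(** * Euclidean inner product and the vector inequalities behind the angle argument *)

Section Inner.
Context {R : realType} {d : nat}.
Implicit Types (u v w : 'rV[R]_d).

Lemma innerC u v : inner u v = inner v u.
Proof. by apply: eq_bigr => i _; rewrite mulrC. Qed.

Lemma innerDl u v w : inner (u + v) w = inner u w + inner v w.
Proof.
by rewrite /inner -big_split; apply: eq_bigr => i _; rewrite mxE mulrDl.
Qed.

Lemma innerZl a u v : inner (a *: u) v = a * inner u v.
Proof.
by rewrite /inner mulr_sumr; apply: eq_bigr => i _; rewrite mxE mulrA.
Qed.

Lemma innerNl u v : inner (- u) v = - inner u v.
Proof. by rewrite -scaleN1r innerZl mulN1r. Qed.

Lemma innerDr u v w : inner w (u + v) = inner w u + inner w v.
Proof. by rewrite innerC innerDl !(innerC w). Qed.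

Lemma innerZr a u v : inner v (a *: u) = a * inner v u.
Proof. by rewrite innerC innerZl innerC. Qed.

Lemma innerNr u v : inner v (- u) = - inner v u.
Proof. by rewrite innerC innerNl innerC. Qed.

Definition innerE :=
  (innerDl, innerDr, innerNl, innerNr, innerZl, innerZr).

Lemma inner_ge0 u : 0 <= inner u u.
Proof. by apply: sumr_ge0 => i _; rewrite -expr2 sqr_ge0. Qed.

Lemma inner_eq0 u : inner u u = 0 -> u = 0.
Proof.
move=> /psumr_eq0P u0; apply/rowP => i; rewrite mxE; apply/eqP.
by rewrite -sqrf_eq0 expr2 u0 // => j _; rewrite -expr2 sqr_ge0.
Qed.

Lemma norm2_ge0 u : 0 <= norm2 u.
Proof. exact: sqrtr_ge0. Qed.

Lemma norm2_sqr u : norm2 u ^+ 2 = inner u u.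
Proof.
rewrite sqr_sqrtr; first by apply: eq_bigr.
by apply: sumr_ge0 => i _; exact: sqr_ge0.
Qed.

Lemma norm2_eq0 u : norm2 u = 0 -> u = 0.
Proof. by move=> u0; apply: inner_eq0; rewrite -norm2_sqr u0 expr0n. Qed.

(** Cauchy-Schwarz: the squared length of [|v| u - |u| v] equals [2 |u| |v| (|u| |v| - <u, v>)], and
    for nonzero vectors the factor [2 |u| |v|] can be cancelled. *)
Lemma inner_le_norm2 u v : inner u v <= norm2 u * norm2 v.
Proof.
have [->|u0] := eqVneq u 0.
  by rewrite -(scale0r 0) innerZl mul0r mulr_ge0 ?norm2_ge0.
have [->|v0] := eqVneq v 0.
  by rewrite -(scale0r 0) innerZr mul0r mulr_ge0 ?norm2_ge0.
have a0 : 0 < norm2 u.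
  by rewrite lt_def norm2_ge0 andbT; apply: contra_neq u0 => /norm2_eq0.
have b0 : 0 < norm2 v.
  by rewrite lt_def norm2_ge0 andbT; apply: contra_neq v0 => /norm2_eq0.
have := inner_ge0 (norm2 v *: u - norm2 u *: v).
rewrite !innerE (innerC v u) -!norm2_sqr.
rewrite (_ : _ + _ = 2 * (norm2 u * norm2 v) * (norm2 u * norm2 v - inner u v)).
  by rewrite pmulr_rge0 ?subr_ge0 // !mulr_gt0.
ring.
Qed.

Lemma norm2_le u v : (forall i, `|u 0 i| <= v 0 i) -> norm2 u <= norm2 v.
Proof.
move=> uv; apply: ler_wsqrtr; apply: ler_sum => i _.
rewrite -(real_normK (num_real (u 0 i))) lerXn2r ?nnegrE //.
exact: le_trans (uv i).
Qed.

(* Write [e = g - m], of norm at most [r]. After clearing denominators the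
   claim reads [<r^2 m + M^2 e, p> <= r M <g, p> / c], and its left-hand
   vector has norm at most [r M |g|], because
   [(r M |m + e|)^2 - |r^2 m + M^2 e|^2 = M^2 (M^2 - r^2) (r^2 - |e|^2)]. *)
Lemma finite_difference_angle (c r : R) (m g p : 'rV[R]_d) :
  0 < c -> c <= 1 -> r < c * norm2 m -> norm2 (g - m) <= r ->
  c * (norm2 g * norm2 p) <= inner g p ->
  inner g p <=
  c * (norm2 m ^+ 2 - r ^+ 2) / (norm2 m * (c * norm2 m - r)) * inner m p.
Proof.
move=> c0 c1 rcM er gp.
have r0 : 0 <= r := le_trans (norm2_ge0 _) er.
have M0 : 0 < norm2 m by rewrite -(pmulr_rgt0 _ c0) (le_lt_trans r0).
have rM : r < norm2 m by apply: (lt_le_trans rcM); rewrite ler_piMl ?norm2_ge0.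
move: er; have : g = m + (g - m) by rewrite addrC subrK.
move: (g - m) => e gE er.
have we : norm2 (r ^+ 2 *: m + norm2 m ^+ 2 *: e) <= r * norm2 m * norm2 g.
  rewrite -(@ler_pXn2r _ 2) ?nnegrE ?mulr_ge0 ?norm2_ge0 //.
  rewrite [in leRHS]exprMn !norm2_sqr gE !innerE (innerC e m) -!norm2_sqr.
  rewrite -subr_ge0.
  rewrite (_ : _ - _ = norm2 m ^+ 2 * (norm2 m ^+ 2 - r ^+ 2)
    * (r ^+ 2 - norm2 e ^+ 2)); last by ring.
  rewrite !mulr_ge0 ?sqr_ge0 ?subr_ge0 ?lerXn2r ?nnegrE ?norm2_ge0 //.
  exact: ltW.
have wp : c * inner (r ^+ 2 *: m + norm2 m ^+ 2 *: e) p
    <= r * norm2 m * inner g p.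
  apply: (@le_trans _ _ (c * (r * norm2 m * norm2 g * norm2 p))).
    rewrite ler_pM2l //; apply: (le_trans (inner_le_norm2 _ _)).
    by rewrite ler_wpM2r ?norm2_ge0.
  rewrite (_ : _ * _ = r * norm2 m * (c * (norm2 g * norm2 p))); last by ring.
  by rewrite ler_wpM2l // mulr_ge0 // norm2_ge0.
rewrite mulrAC ler_pdivlMr ?mulr_gt0 ?subr_gt0 //.
rewrite -subr_ge0 gE !innerE in wp; rewrite -subr_ge0 gE !innerE.
by rewrite (le_trans wp) // le_eqVlt; apply/orP; left; apply/eqP; ring.
Qed.

(* The bound is used at [u = k (g - mu p)]: [k = 1 / (L - mu)] is optimal, and
   for [L = mu] any large [k] forces [g = mu p]. *)
Lemma coercive_of_bounds (mu L : R) (g p : 'rV[R]_d) :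
  mu <= L ->
  (forall u, mu * inner p p + 2 * inner (g - mu *: p) u - (L - mu) * inner u u
     <= inner g p) ->
  mu * L * inner p p + inner g g <= (mu + L) * inner g p.
Proof.
move=> muL; move qE : (g - mu *: p) => q H.
have Hk k := H (k *: q).
have key : inner q q <= (L - mu) * (inner g p - mu * inner p p).
  have [lt0|] := ltrP 0 (L - mu); last first.
    rewrite subr_le0 => Lmu.
    have {Lmu muL} e : L = mu by apply/eqP; rewrite eq_le Lmu.
    rewrite e subrr mul0r leNgt; apply/negP => q0.
    (* With no quadratic term left, this [k] makes the linear term exceed the available gap
       [<g, p> - mu |p|^2] by exactly 1. *)
    have := Hk ((inner g p - mu * inner p p + 1) / (2 * inner q q)).
    rewrite e subrr mul0r subr0 innerZr.
    rewrite (_ : 2 * _ = inner g p - mu * inner p p + 1); first by lra.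
    by field; rewrite gt_eqF.
  have := Hk (L - mu)^-1; rewrite !innerE.
  rewrite (_ : _ - _ = mu * inner p p + inner q q / (L - mu)).
    rewrite -lerBrDl ler_pdivrMr // => h; apply: (le_trans h); lra.
  by field; rewrite gt_eqF.
move: key; rewrite -qE !innerE (innerC p g); lra.
Qed.

(** AM-GM in the form [2 sqrt(mu L) |p| |g| <= mu L |p|^2 + |g|^2]. *)
Lemma angle_of_coercive (mu L : R) (g p : 'rV[R]_d) :
  0 < mu -> mu <= L ->
  mu * L * inner p p + inner g g <= (mu + L) * inner g p ->
  2 * Num.sqrt (mu * L) / (mu + L) * (norm2 g * norm2 p) <= inner g p.
Proof.
move=> mu0 muL H.
have L0 := lt_le_trans mu0 muL.
rewrite mulrAC ler_pdivrMr ?addr_gt0 // [leRHS]mulrC (le_trans _ H) //.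
have := sqr_ge0 (Num.sqrt (mu * L) * norm2 p - norm2 g).
rewrite sqrrB exprMn sqr_sqrtr; last by rewrite mulr_ge0 ?ltW.
by rewrite !norm2_sqr; lra.
Qed.
End Inner.

(** * Directional derivatives: restriction to lines, homogeneity and additivity in the direction *)

Section Directional.
Context {R : realType} {V : normedModType R}.
Implicit Types (f : V -> R) (x u w : V).

(** Both derivatives are limits of the same difference quotient; this transfers one-variable
    calculus to directional derivatives. *)
Lemma is_derive_lineP f x u (t D : R) :
  is_derive (x + t *: u) u f D <-> is_derive t 1 (fun s => f (x + s *: u)) D.
Proof.
have E : (fun h : R => h^-1 *: (((fun s => f (x + s *: u)) \o shift t) (h *: 1)
     - f (x + t *: u)))
   = (fun h => h^-1 *: ((f \o shift (x + t *: u)) (h *: u) - f (x + t *: u))).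
  apply/funext => h /=; congr (_ *: (f _ - _)).
  by rewrite [h *: 1]mulr1 scalerDl addrCA.
by split=> -[]; rewrite /derivable /derive ?E => d1 d2; split;
  rewrite /derivable /derive ?E.
Qed.

Lemma MVT_line f x u : (forall z, derivable f z u) ->
  exists2 t, 0 <= t <= 1 & f (x + u) - f x = 'D_u f (x + t *: u).
Proof.
move=> fu.
have df (t : R) : is_derive t 1 (fun s => f (x + s *: u)) ('D_u f (x + t *: u)).
  by apply/is_derive_lineP; exact: derivableP.
have [|t t01] := MVT_segment (@ler01 R) (fun t _ => df t).
  by apply: derivable_within_continuous => t _; have [] := df t.
rewrite scale1r scale0r addr0 subr0 mulr1 => E.
by exists t.
Qed.

Lemma is_deriveZ_dir f x u (a : R) : derivable f x u ->
  is_derive x (a *: u) f (a * 'D_u f x).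
Proof.
move=> /derivableP; move: ('D_u f x) => D fu.
rewrite -[x]addr0 -(scale0r (a *: u)); apply/is_derive_lineP.
have -> : (fun s => f (x + s *: (a *: u))) =
    (fun s => f (x + s *: u)) \o (fun s => s * a).
  by apply/funext => s /=; rewrite scalerA.
rewrite mulrC; apply: is_derive1_comp.
  rewrite mul0r; apply/is_derive_lineP; by rewrite scale0r addr0.
by apply: is_derive_eq; rewrite scaler0 add0r [_ *: _]mulr1.
Qed.

(* The increment in the direction [u], taken at the moving base point [x + h w],
   is handled by the mean value theorem, so only ['D_u f] has to be
   continuous. *)
Lemma is_derive_addr f x u w :
  (forall z, derivable f z u) -> {for x, continuous ('D_u f)} ->
  derivable f x w ->
  is_derive x (u + w) f ('D_u f x + 'D_w f x).
Proof.
move=> fu cu fw.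
suff : (fun h : R => h^-1 *: ((f \o shift x) (h *: (u + w)) - f x)) @ 0^'
    --> 'D_u f x + 'D_w f x.
  by move=> H; split; [apply: (cvgP _ H)|apply/cvg_lim].
have -> : (fun h : R => h^-1 *: ((f \o shift x) (h *: (u + w)) - f x)) =
   (fun h : R => h^-1 *: (f (x + h *: w + h *: u) - f (x + h *: w))) \+
   (fun h : R => h^-1 *: ((f \o shift x) (h *: w) - f x)).
  apply/funext => h /=; rewrite -scalerDr [x + h *: w]addrC addrA subrK.
  by rewrite [h *: (u + w)]scalerDr -[in LHS]addrA [in LHS]addrC.
apply: cvgD; last exact: fw.
apply/cvgrPdist_lt => e e0.
move/cvgrPdist_lt : cu => /(_ _ e0) /nbhs_ballP [r r0 rP].
(* The mean value point lies within [|h| (|w| + |u|)] of [x], so this keeps it in the ball where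
   ['D_u f] is [e]-close to its value at [x]. The [+ 1] below keeps the divisor positive even when
   [u = w = 0]. *)
have : \forall h \near (0 : R)^', `|h| * (`|w| + `|u|) < r.
  have K0 : 0 < `|w| + `|u| + 1 by rewrite ltr_wpDl ?addr_ge0.
  have := @dnbhs0_lt _ R _ (divr_gt0 r0 K0).
  apply: filterS => h; rewrite ltr_pdivlMr //; apply: le_lt_trans.
  by rewrite ler_wpM2l // lerDl.
have : \forall h \near (0 : R)^', h != 0 by exact: nbhs_dnbhs_neq.
apply: filterS2 => h h0 hr.
have [z|t /andP[t0 t1] ->] := @MVT_line f (x + h *: w) (h *: u).
  by have [] := is_deriveZ_dir f z u h (fu z).
have [_ ->] := is_deriveZ_dir f (x + h *: w + t *: (h *: u)) u h (fu _).
rewrite [_ *: _]mulrA mulVf // mul1r; apply: rP.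
rewrite -ball_normE /ball_ /= -addrA opprD addrA subrr sub0r normrN.
apply: le_lt_trans hr; rewrite mulrDr (le_trans (ler_normD _ _)) //.
rewrite !normrZ lerD2l.
by rewrite ler_piMl ?mulr_ge0 // ger0_norm.
Qed.

End Directional.

(** * Second-order Taylor bound in one variable *)

Section Taylor.
Context {R : realType}.

(** Subtracting the quadratic [a / 2 * t ^+ 2 + h1 0 * t] leaves [g] with [g' 0 = 0] and [g'' >= 0];
    two uses of the mean value theorem give [g' >= 0] on the unit interval, then [g 0 <= g 1]. *)
Lemma second_order_lower (h h1 h2 : R -> R) (a : R) :
  (forall t : R, is_derive t 1 h (h1 t)) ->
  (forall t : R, is_derive t 1 h1 (h2 t)) ->
  (forall t, a <= h2 t) -> h 0 + h1 0 + a / 2 <= h 1.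
Proof.
move=> dh dh1 ah2.
pose g (t : R) := h t - (a / 2 * t ^+ 2 + h1 0 * t).
pose g1 (t : R) := h1 t - (a * t + h1 0).
have dg (t : R) : is_derive t 1 g (g1 t).
  apply: is_deriveB; apply: is_derive_eq.
  by rewrite /GRing.scale /=; field.
have dg1 (t : R) : is_derive t 1 g1 (h2 t - a).
  apply: is_deriveB; apply: is_derive_eq.
  by rewrite /GRing.scale /=; ring.
have cont (k k' : R -> R) : (forall t : R, is_derive t 1 k (k' t)) -> forall b,
    {within `[0, b], continuous (k : R -> R)}.
  by move=> dk b; apply: derivable_within_continuous => t _; have [] := dk t.
have [t] := MVT_segment (@ler01 R) (fun t _ => dg t) (cont _ _ dg _).
rewrite in_itv /= => /andP[t0 _] E.
have [s _ E1] := MVT_segment t0 (fun t _ => dg1 t) (cont _ _ dg1 _).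
have : 0 <= g1 t.
  have := mulr_ge0 (_ : 0 <= h2 s - a) t0; rewrite subr_ge0 ah2 => /(_ isT).
  by move: E1; rewrite /g1; lra.
by move: E; rewrite /g; lra.
Qed.

End Taylor.

(** * Gradient, Hessian and quadratic bounds along lines *)

Section ContinuousPartials.
Context {R : realType} {d : nat}.
Implicit Types (f : 'rV[R]_d -> R) (x v : 'rV[R]_d).

Lemma is_derive_C1 f x v : C1 f ->
  is_derive x v f (\sum_i v 0 i * partial f i x).
Proof.
move=> [df cf].
(* The direction is built up one coordinate at a time; each new summand has a continuous directional
   derivative, as [is_derive_addr] requires. *)
have sumE (s : seq 'I_d) : is_derive x (\sum_(i <- s) v 0 i *: e_ R i) f
    (\sum_(i <- s) v 0 i * partial f i x).
  elim: s => [|i s [ds Ds]]; first by rewrite !big_nil; exact: is_derive0.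
  have di z := is_deriveZ_dir f z _ (v 0 i) (df i z).
  rewrite !big_cons -Ds.
  have [_ <-] := di x; apply: is_derive_addr ds => [z|].
    by have [] := di z.
  have -> : 'D_(v 0 i *: e_ R i) f = (fun z => v 0 i * partial f i z).
    by apply/funext => z; have [] := di z.
  by apply: continuousM; [exact: cst_continuous|exact: cf].
have := sumE (index_enum 'I_d).
by rewrite -row_sum_delta.
Qed.

Definition gradient f x : 'rV[R]_d := \row_i partial f i x.

Lemma is_derive_gradient f x v (t : R) : C1 f ->
  is_derive t 1 (fun s => f (x + s *: v)) (inner (gradient f (x + t *: v)) v).
Proof.
move=> f1; apply: (is_derive_lineP f x v t _).1.
rewrite (_ : inner _ _ = \sum_i v 0 i * partial f i (x + t *: v)).
  exact: is_derive_C1.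
by apply: eq_bigr => i _; rewrite mxE mulrC.
Qed.

Lemma is_derive_hessian f x v (t : R) : C2 f ->
  is_derive t 1 (fun s => inner (gradient f (x + s *: v)) v)
    (inner (v *m hessian f (x + t *: v)) v).
Proof.
move=> [f1 f2].
rewrite (_ : inner _ _ =
    \sum_i v 0 i * inner (gradient (partial f i) (x + t *: v)) v).
  rewrite (_ : (fun s => _) =
      \sum_i (v 0 i \*: (fun s => partial f i (x + s *: v)))).
    apply: is_derive_sum => i; apply: is_deriveZ; exact: is_derive_gradient.
  apply/funext => s; rewrite fct_sumE.
  by apply: eq_bigr => i _; rewrite mxE mulrC.
(* Both sides are the same double sum over Hessian entries, taken in opposite orders. *)
rewrite /inner; under eq_bigr do rewrite mxE mulr_suml.
rewrite exchange_big; apply: eq_bigr => i _; rewrite mulr_sumr.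
by apply: eq_bigr => j _; rewrite !mxE mulrA.
Qed.

Lemma quadratic_lower_bound f (a : R) (x v : 'rV[R]_d) : C2 f ->
  (forall y, a * inner v v <= inner (v *m hessian f y) v) ->
  f x + inner (gradient f x) v + a / 2 * inner v v <= f (x + v).
Proof.
move=> f2 ha.
have := second_order_lower _ _ _ _ (fun t => is_derive_gradient f x v t f2.1)
  (fun t => is_derive_hessian f x v t f2) (fun t => ha _).
by rewrite scale0r scale1r addr0 mulrAC.
Qed.

Lemma quadratic_upper_bound f (b : R) (x v : 'rV[R]_d) : C2 f ->
  (forall y, inner (v *m hessian f y) v <= b * inner v v) ->
  f (x + v) <= f x + inner (gradient f x) v + b / 2 * inner v v.
Proof.
move=> f2 hb.
(* The upper bound is the lower bound for [- f] along the line. *)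
have := second_order_lower _ _ _ (- (b * inner v v))
  (fun t => is_deriveN (is_derive_gradient f x v t f2.1))
  (fun t => is_deriveN (is_derive_hessian f x v t f2)).
rewrite /= !fctE scale0r scale1r addr0 => H.
have : forall t : R,
    - (b * inner v v) <= - inner (v *m hessian f (x + t *: v)) v.
  by move=> t; rewrite lerN2.
by move=> /H; lra.
Qed.
End ContinuousPartials.

(** * Consequences of the two-sided Hessian bound *)

Section StronglyConvexSmooth.
Context {R : realType} {d : nat} (mu L : R) (f : 'rV[R]_d -> R).
Hypotheses (mu0 : 0 < mu) (muL : mu <= L) (f2 : C2 f).
Hypothesis hess : forall y,
  loewner_le mu%:M (hessian f y) /\ loewner_le (hessian f y) L%:M.
Implicit Types (x u v xstar : 'rV[R]_d).

Let L0 : 0 < L := lt_le_trans mu0 muL.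

Lemma strongly_convex_lower x v :
  f x + inner (gradient f x) v + mu / 2 * inner v v <= f (x + v).
Proof.
apply: quadratic_lower_bound => // y; have [+ _] := hess y.
by move=> /(_ v); rewrite mulmxBr mul_mx_scalar !innerE subr_ge0.
Qed.

Lemma smooth_upper x v :
  f (x + v) <= f x + inner (gradient f x) v + L / 2 * inner v v.
Proof.
apply: quadratic_upper_bound => // y; have [_] := hess y.
by move=> /(_ v); rewrite mulmxBr mul_mx_scalar !innerE subr_ge0.
Qed.

Lemma gradient_tangent x v : f x + inner (gradient f x) v <= f (x + v).
Proof.
apply: le_trans (strongly_convex_lower x v).
by rewrite lerDl mulr_ge0 ?inner_ge0 // ltW // divr_gt0.
Qed.

(** A gradient step of size [1 / L] decreases [f] by at least [|g|^2 / (2 L)], which at a minimizer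
    forces [g = 0]. *)
Lemma gradient_minimizer xstar : (forall y, f xstar <= f y) ->
  gradient f xstar = 0.
Proof.
move=> fmin; apply: inner_eq0; apply/eqP; rewrite eq_le inner_ge0 andbT.
set g := inner _ _.
have := le_trans (fmin _) (smooth_upper xstar (- (L^-1 *: gradient f xstar))).
rewrite !innerE -/g.
rewrite (_ : _ + _ = f xstar - g / (2 * L)); last by field; rewrite gt_eqF.
by rewrite lerBrDr gerDl pmulr_lle0 // invr_gt0 mulr_gt0.
Qed.

Lemma gradient_coercive xstar x : (forall y, f xstar <= f y) ->
  mu * L * inner (x - xstar) (x - xstar)
    + inner (gradient f x) (gradient f x)
  <= (mu + L) * inner (gradient f x) (x - xstar).
Proof.
move=> fmin; apply: coercive_of_bounds => // u.
have g0 := gradient_minimizer _ fmin.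
move: (x - xstar) (subrK xstar x) => p xE.
(* The values [f (x - u)] and [f (xstar + u)] are each bounded below from one of the points [x],
   [xstar] and above from the other; in the sum of the four bounds all values of [f] cancel. *)
have lo1 := strongly_convex_lower xstar (p - u).
have up1 := smooth_upper x (- u).
have lo2 := strongly_convex_lower x (u - p).
have up2 := smooth_upper xstar u.
have e1 : xstar + (p - u) = x - u by rewrite -xE addrA (addrC p).
have e2 : x + (u - p) = xstar + u by rewrite -xE addrC addrA subrK addrC.
move: lo1 up1 lo2 up2; rewrite e1 e2 g0 -(scale0r u) !innerE !mul0r.
rewrite (innerC u p); lra.
Qed.

(** [m_i - r_i] and [m_i + r_i] are the backward and forward difference quotients, and the tangent
    inequality at [x] places the [i]-th partial derivative between them. *)
Lemma gradient_finite_difference (eps : R) x : 0 < eps ->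
  norm2 (gradient f x - m_vec f eps x) <= norm2 (r_vec f eps x).
Proof.
move=> eps0; apply: norm2_le => i.
have gE : inner (gradient f x) (e_ R i) = gradient f x 0 i.
  rewrite /inner (bigD1 i) //= big1 ?addr0 => [|j ji].
    by rewrite [X in _ * X]mxE !eqxx mulr1.
  by rewrite [X in _ * X]mxE (negPf ji) andbF mulr0.
have fp := gradient_tangent x (eps *: e_ R i).
have fm := gradient_tangent x (- (eps *: e_ R i)).
rewrite !innerE gE in fp fm.
have e2 : 0 < 2 * eps by rewrite mulr_gt0.
rewrite !mxE in fp fm *.
rewrite ler_norml; apply/andP; split.
  by rewrite lerBrDr -mulNr -mulrDl ler_pdivrMr //; lra.
by rewrite lerBlDr -mulrDl ler_pdivlMr //; lra.
Qed.

End StronglyConvexSmooth.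

(** * Nonnegativity of the divergence at the minimizer *)

Theorem corollary6p1 (R : realType) (d : nat) (mu L : R)
    (f : 'rV[R]_d -> R) (xstar : 'rV[R]_d) (eps : R) (x : 'rV[R]_d) :
  0 < mu -> mu <= L ->
  convex_function setT f ->
  C2 f ->
  (forall y, loewner_le mu%:M (hessian f y) /\ loewner_le (hessian f y) L%:M) ->
  (forall y, f xstar <= f y) ->
  0 < eps ->
  let c := 2 * Num.sqrt (mu * L) / (mu + L) in
  ~ exceptional_set f eps c x ->
  0 <= divergence f (Omega f eps c) xstar x /\
  inner (Omega f eps c x) (x - xstar) >= f x - f xstar.
Proof.
move=> mu0 muL _ f2 hess fmin eps0 c xV.
have L0 := lt_le_trans mu0 muL.
have c0 : 0 < c by rewrite divr_gt0 ?addr_gt0 // mulr_gt0 // sqrtr_gt0 mulr_gt0.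
have c1 : c <= 1.
  rewrite ler_pdivrMr ?addr_gt0 // mul1r.
  (* [c <= 1] is the AM-GM inequality for [mu] and [L]. *)
  have := sqr_ge0 (Num.sqrt mu - Num.sqrt L).
  rewrite sqrrB !sqr_sqrtr ?(ltW mu0) ?(ltW L0) // sqrtrM ?(ltW mu0) //; lra.
suff H : f x - f xstar <= inner (Omega f eps c x) (x - xstar).
  by split=> //; rewrite /divergence; lra.
apply: (@le_trans _ _ (inner (gradient f x) (x - xstar))).
  have := gradient_tangent _ _ _ mu0 f2 hess x (xstar - x).
  by rewrite [x + _]addrC subrK !innerE; lra.
rewrite innerZl; apply: finite_difference_angle => //.
- move/negP : xV; rewrite -ltNge ltr_pdivrMr // mulrC; exact.
- exact: (gradient_finite_difference _ _ _ mu0 f2 hess).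
- apply: angle_of_coercive => //.
  exact: (gradient_coercive _ _ _ mu0 muL f2 hess).
Qed.
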